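(* Let $U$ be the forgetful functor from the category $(0,\infty)\text{-}\mathbb{C}\mathbb{E}\mathrm{tC}$ of cubical $(0,\infty)$-categorical stretchings to $\mathbb{C}\mathrm{Sets}\times\mathbb{C}\mathrm{Sets}$, sending a $(0,\infty)$-stretching $(\mathbb{E}_0,\mathbb{E}_1,F_M,F_C)$ to the pair $(M_0,M_1)$ of underlying cubical sets of the magmas of $\mathbb{E}_0$ and $\mathbb{E}_1$. Then $U$ has a left adjoint, and hence the adjunction produces a monad $\mathbb{T}^0=(T^0,\lambda^0,\mu^0)$ on $\mathbb{C}\mathrm{Sets}\times\mathbb{C}\mathrm{Sets}$.
   Context: **Cubical sets.** A cubical set is a family of sets $(C_n)_{n\ge 0}$ with maps (sources and targets) $s^n_{n-1,j},t^n_{n-1,j}:C_n\to C_{n-1}$ for $n\ge1$, $1\le j\le n$, such that for $1\le i<j\le n$: $s^{n-1}_{n-2,i}s^n_{n-1,j}=s^{n-1}_{n-2,j-1}s^n_{n-1,i}$; $s^{n-1}_{n-2,i}t^n_{n-1,j}=t^{n-1}_{n-2,j-1}s^n_{n-1,i}$; $t^{n-1}_{n-2,i}s^n_{n-1,j}=s^{n-1}_{n-2,j-1}t^n_{n-1,i}$; $t^{n-1}_{n-2,i}t^n_{n-1,j}=t^{n-1}_{n-2,j-1}t^n_{n-1,i}$. Morphisms are families of maps commuting with all sources and targets. The category is $\mathbb{C}\mathrm{Sets}$. **Reflexive cubical sets.** A reflexive cubical set is a cubical set with maps $1^{n}_{n+1,j}:C_n\to C_{n+1}$ ($n\ge0$,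 $1\le j\le n+1$; classical reflexions) and $1^{n,\gamma}_{n+1,j}:C_n\to C_{n+1}$ ($n\ge1$, $1\le j\le n$, $\gamma\in\{+,-\}$; connections) such that, whenever the maps are defined (and with $r$ denoting either $s$ everywhere or $t$ everywhere): - $1^n_{n+1,i}1^{n-1}_{n,j}=1^n_{n+1,j+1}1^{n-1}_{n,i}$ for $1\le i\le j\le n$; - $r^n_{n-1,i}1^{n-1}_{n,j}=1^{n-2}_{n-1,j-1}r^{n-1}_{n-2,i}$ for $1\le i<j\le n$; $=1^{n-2}_{n-1,j}r^{n-1}_{n-2,i-1}$ for $1\le j<i\le n$; $=\mathrm{id}$ for $i=j$; - $1^{n,\gamma}_{n+1,i}1^{n-1,\gamma}_{n,j}=1^{n,\gamma}_{n+1,j+1}1^{n-1,\gamma}_{n,i}$ for $1\le i<j\le n-1$, and $1^{n,\gamma}_{n+1,i}1^{n-1,\gamma}_{n,i}=1^{n,\gamma}_{n+1,i+1}1^{n-1,\gamma}_{n,i}$ for $1\le i\le n-1$; - $1^{n,\gamma}_{n+1,i}1^{n-1}_{n,j}=1^n_{n+1,j+1}1^{n-1,\gamma}_{n,i}$ for $1\le i<j\le n$; $=1^n_{n+1,j}1^{n-1,\gamma}_{n,i-1}$ for $1\le j<i\le n$; and $1^{n,\gamma}_{n+1,j}1^{n-1}_{n,j}=1^n_{n+1,j}1^{n-1}_{n,j}$ for $1\le j\le n$; - $r^n_{n-1,i}1^{n-1,\gamma}_{n,j}=1^{n-2,\gamma}_{n-1,j-1}r^{n-1}_{n-2,i}$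 for $1\le i<j\le n-1$; $=1^{n-2,\gamma}_{n-1,j}r^{n-1}_{n-2,i-1}$ for $2\le j+1<i\le n$; - for $1\le j\le n-1$: $s^n_{n-1,j}1^{n-1,-}_{n,j}=s^n_{n-1,j+1}1^{n-1,-}_{n,j}=\mathrm{id}$, $t^n_{n-1,j}1^{n-1,+}_{n,j}=t^n_{n-1,j+1}1^{n-1,+}_{n,j}=\mathrm{id}$, $s^n_{n-1,j}1^{n-1,+}_{n,j}=s^n_{n-1,j+1}1^{n-1,+}_{n,j}=1^{n-2}_{n-1,j}s^{n-1}_{n-2,j}$, $t^n_{n-1,j}1^{n-1,-}_{n,j}=t^n_{n-1,j+1}1^{n-1,-}_{n,j}=1^{n-2}_{n-1,j}t^{n-1}_{n-2,j}$. **Cubical reflexive $\infty$-magmas.** A reflexive cubical set with partial operations $\circ^n_j$ on $C_n$ ($n\ge1$, $1\le j\le n$), where $a\circ^n_jb$ is defined exactly when $t^n_{n-1,j}(a)=s^n_{n-1,j}(b)$, such that $s^n_{n-1,j}(a\circ^n_jb)=s^n_{n-1,j}(a)$, $t^n_{n-1,j}(a\circ^n_jb)=t^n_{n-1,j}(b)$, and for $r\in\{s,t\}$: $r^n_{n-1,i}(a\circ^n_jb)=r^n_{n-1,i}(a)\circ^{n-1}_{j-1}r^n_{n-1,i}(b)$ if $i<j$, and $=r^n_{n-1,i}(a)\circ^{n-1}_{j}r^n_{n-1,i}(b)$ if $j<i$. Morphisms are maps commuting with sources, targets, reflexions, connections and the operations $\circ^n_j$. The category is $\infty\text{-}\mathbb{C}\mathbb{M}\mathrm{ag}_r$.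 **Strict cubical $\infty$-categories.** A strict cubical $\infty$-category is a cubical reflexive $\infty$-magma such that the operations are associative and unital ($1^{n-1}_{n,j}(s^n_{n-1,j}(a))\circ^n_ja=a=a\circ^n_j1^{n-1}_{n,j}(t^n_{n-1,j}(a))$), and such that: - interchange: $(a\circ^n_ib)\circ^n_j(c\circ^n_id)=(a\circ^n_jc)\circ^n_i(b\circ^n_jd)$ for $i\ne j$ whenever both sides are defined; - $1^n_{n+1,i}(a\circ^n_jb)=1^n_{n+1,i}(a)\circ^{n+1}_{j+1}1^n_{n+1,i}(b)$ if $1\le i\le j\le n$, and $=1^n_{n+1,i}(a)\circ^{n+1}_j1^n_{n+1,i}(b)$ if $1\le j<i\le n+1$; - $1^{n,\gamma}_{n+1,i}(a\circ^n_jb)=1^{n,\gamma}_{n+1,i}(a)\circ^{n+1}_{j+1}1^{n,\gamma}_{n+1,i}(b)$ if $1\le i<j\le n$, and $=1^{n,\gamma}_{n+1,i}(a)\circ^{n+1}_j1^{n,\gamma}_{n+1,i}(b)$ if $1\le j<i\le n$; - transport laws, for $1\le j\le n$: $1^{n,+}_{n+1,j}(a\circ^n_jb)=\bigl(1^{n,+}_{n+1,j}(a)\circ^{n+1}_j1^n_{n+1,j}(a)\bigr)\circ^{n+1}_{j+1}\bigl(1^n_{n+1,j+1}(a)\circ^{n+1}_j1^{n,+}_{n+1,j}(b)\bigr)$ and $1^{n,-}_{n+1,j}(a\circ^n_jb)=\bigl(1^{n,-}_{n+1,j}(a)\circ^{n+1}_j1^n_{n+1,j+1}(b)\bigr)\circ^{n+1}_{j+1}\bigl(1^n_{n+1,j}(b)\circ^{n+1}_j1^{n,-}_{n+1,j}(b)\bigr)$;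 - for $1\le i\le n$: $1^{n,+}_{n+1,i}(x)\circ^{n+1}_i1^{n,-}_{n+1,i}(x)=1^n_{n+1,i+1}(x)$ and $1^{n,+}_{n+1,i}(x)\circ^{n+1}_{i+1}1^{n,-}_{n+1,i}(x)=1^n_{n+1,i}(x)$. Strict cubical $\infty$-functors are the morphisms of cubical reflexive $\infty$-magmas between strict cubical $\infty$-categories. **Cubical categorical stretchings.** An object of $\infty\text{-}\mathbb{C}\mathbb{E}\mathrm{tC}$ is a quintuple $(M,C,\pi,([-;-]^n_{n+1,j})_{n\ge0,1\le j\le n+1},([-;-]^{n,\gamma}_{n+1,j})_{n\ge1,1\le j\le n,\gamma\in\{-,+\}})$ with $M$ a cubical reflexive $\infty$-magma, $C$ a strict cubical $\infty$-category, $\pi:M\to C$ a morphism of $\infty\text{-}\mathbb{C}\mathbb{M}\mathrm{ag}_r$, and bracketing maps as follows. Put $\underline{M}_0=\{(\alpha,\beta)\in M_0\times M_0:\alpha=\beta\}$ and for $n\ge1$, $\underline{M}_n=\{(\alpha,\beta)\in M_n\times M_n:\pi_n(\alpha)=\pi_n(\beta)\}$, $\underline{M}^s_{n,j}=\{(\alpha,\beta)\in\underline{M}_n:s^n_{n-1,j}(\alpha)=s^n_{n-1,j}(\beta)\}$, $\underline{M}^t_{n,j}=\{(\alpha,\beta)\in\underline{M}_n:t^n_{n-1,j}(\alpha)=t^n_{n-1,j}(\beta)\}$. The brackets are maps $[-;-]^n_{n+1,j}:\underline{M}_n\to M_{n+1}$, $[-;-]^{n,-}_{n+1,j}:\underline{M}^s_{n,j}\to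 M_{n+1}$, $[-;-]^{n,+}_{n+1,j}:\underline{M}^t_{n,j}\to M_{n+1}$ satisfying (each equation includes the requirement that the brackets in it be defined; $r\in\{s,t\}$): - $r^{n+1}_{n,i}([\alpha;\beta]^n_{n+1,j})=[r^n_{n-1,i}(\alpha);r^n_{n-1,i}(\beta)]^{n-1}_{n,j-1}$ if $1\le i<j\le n+1$; $=[r^n_{n-1,i-1}(\alpha);r^n_{n-1,i-1}(\beta)]^{n-1}_{n,j}$ if $1\le j<i\le n+1$; $s^{n+1}_{n,j}([\alpha;\beta]^n_{n+1,j})=\alpha$ and $t^{n+1}_{n,j}([\alpha;\beta]^n_{n+1,j})=\beta$; - $\pi_{n+1}([\alpha;\beta]^n_{n+1,j})=1^n_{n+1,j}(\pi_n(\alpha))=1^n_{n+1,j}(\pi_n(\beta))$, and $[\alpha;\alpha]^n_{n+1,j}=1^n_{n+1,j}(\alpha)$ for all $\alpha\in M_n$; - for $1\le j\le n$: $s^{n+1}_{n,j}([\alpha;\beta]^{n,-}_{n+1,j})=\alpha$, $s^{n+1}_{n,j+1}([\alpha;\beta]^{n,-}_{n+1,j})=\beta$, $t^{n+1}_{n,j}([\alpha;\beta]^{n,+}_{n+1,j})=\alpha$, $t^{n+1}_{n,j+1}([\alpha;\beta]^{n,+}_{n+1,j})=\beta$, $s^{n+1}_{n,j}([\alpha;\beta]^{n,+}_{n+1,j})=s^{n+1}_{n,j+1}([\alpha;\beta]^{n,+}_{n+1,j})=[s^n_{n-1,j}(\alpha);s^n_{n-1,j}(\beta)]^{n-1}_{n,j}$,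 $t^{n+1}_{n,j}([\alpha;\beta]^{n,-}_{n+1,j})=t^{n+1}_{n,j+1}([\alpha;\beta]^{n,-}_{n+1,j})=[t^n_{n-1,j}(\alpha);t^n_{n-1,j}(\beta)]^{n-1}_{n,j}$; - $r^{n+1}_{n,i}([\alpha;\beta]^{n,\gamma}_{n+1,j})=[r^n_{n-1,i}(\alpha);r^n_{n-1,i}(\beta)]^{n-1,\gamma}_{n,j-1}$ if $1\le i<j\le n$; $=[r^n_{n-1,i-1}(\alpha);r^n_{n-1,i-1}(\beta)]^{n-1,\gamma}_{n,j}$ if $2\le j+1<i\le n+1$; - $\pi_{n+1}([\alpha;\beta]^{n,\gamma}_{n+1,j})=1^{n,\gamma}_{n+1,j}(\pi_n(\alpha))=1^{n,\gamma}_{n+1,j}(\pi_n(\beta))$, and $[\alpha;\alpha]^{n,\gamma}_{n+1,j}=1^{n,\gamma}_{n+1,j}(\alpha)$ for all $\alpha\in M_n$. A morphism from $(M,C,\pi,\dots)$ to $(M',C',\pi',\dots)$ is a pair $(m,c)$ of morphisms $m:M\to M'$, $c:C\to C'$ of $\infty\text{-}\mathbb{C}\mathbb{M}\mathrm{ag}_r$ with $\pi'm=c\pi$, such that $m$ preserves all brackets: $m_{n+1}([\alpha;\beta]^n_{n+1,j})=[m_n(\alpha);m_n(\beta)]^n_{n+1,j}$ and $m_{n+1}([\alpha;\beta]^{n,\gamma}_{n+1,j})=[m_n(\alpha);m_n(\beta)]^{n,\gamma}_{n+1,j}$. **Cubical $(0,\infty)$-categorical stretchings.** A cubical $(0,\infty)$-magma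 $(M_0,F_M,M_1)$ consists of two cubical reflexive $\infty$-magmas $M_0,M_1$ and a morphism $F_M:M_0\to M_1$ of cubical sets (not required to preserve reflexions, connections or compositions). A morphism $(M_0,F_M,M_1)\to(M_0',F_M',M_1')$ is a pair of morphisms $m_0:M_0\to M_0'$, $m_1:M_1\to M_1'$ of $\infty\text{-}\mathbb{C}\mathbb{M}\mathrm{ag}_r$ with $m_1F_M=F_M'm_0$. A $(0,\infty)$-stretching is $(\mathbb{E}_0,\mathbb{E}_1,F_M,F_C)$ where $\mathbb{E}_0=(M_0,C_0,\pi_0,\dots)$ and $\mathbb{E}_1=(M_1,C_1,\pi_1,\dots)$ are cubical categorical stretchings, $(M_0,F_M,M_1)$ is a cubical $(0,\infty)$-magma, $F_C:C_0\to C_1$ is a strict cubical $\infty$-functor, and $\pi_1F_M=F_C\pi_0$ in $\mathbb{C}\mathrm{Sets}$. A morphism $(\mathbb{E}_0,\mathbb{E}_1,F_M,F_C)\to(\mathbb{E}'_0,\mathbb{E}'_1,F'_M,F'_C)$ is given by morphisms $(m_0,c_0):\mathbb{E}_0\to\mathbb{E}_0'$ and $(m_1,c_1):\mathbb{E}_1\to\mathbb{E}_1'$ of cubical categorical stretchings with $m_1F_M=F'_Mm_0$ and $c_1F_C=F'_Cc_0$. The category is $(0,\infty)\text{-}\mathbb{C}\mathbb{E}\mathrm{tC}$. *)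

(* Defs.v *)
From mathcomp Require Import all_boot.
From mathcomp Require Import boolp.

Set Implicit Arguments.
Unset Strict Implicit.
Unset Printing Implicit Defensive.

#[local] Obligation Tactic := try by [].

(** Conventions.

    - Directions are numbered from 0: the direction [j] of the mathematical
      text, with [1 <= j <= n], is the element of ['I_n] of value [j - 1].
    - In each law, the indices on the right-hand side that differ in type or in
      value from those on the left-hand side are primed variables, and
      hypotheses fix their values as natural numbers; for example
      [j'.+1 = j] says that [j'] is the direction [j - 1].
    - A partial operation takes a proof that it is defined as its last argument.
      Laws assert that the expressions they equate are defined whenever the
      given data are, by an existential quantifier over proofs of definedness.
      Interchange alone is required only when both sides are defined.
    - [refl j] is [1^n_{n+1,j}], [conn g j] is [1^{n,g}_{n+1,j}],
      [brk j a b _] is [[a;b]^n_{n+1,j}] and [cbrk g j a b _] is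
      [[a;b]^{n,g}_{n+1,j}]. *)

(** * Categories, adjunctions, monads *)

Record category := Category {
  obj :> Type;
  hom : obj -> obj -> Type;
  cat_id : forall x, hom x x;
  cat_comp : forall {x y z}, hom y z -> hom x y -> hom x z;
  cat_idl : forall x y (f : hom x y), cat_comp (cat_id y) f = f;
  cat_idr : forall x y (f : hom x y), cat_comp f (cat_id x) = f;
  cat_assoc : forall w x y z (h : hom y z) (g : hom x y) (f : hom w x),
    cat_comp h (cat_comp g f) = cat_comp (cat_comp h g) f
}.
Arguments hom {c} x y.
Arguments cat_id {c} x.
Arguments cat_comp {c x y z} g f : rename.

Record functor (A B : category) := Functor {
  fobj :> A -> B;
  fmap : forall {x y : A}, hom x y -> hom (fobj x) (fobj y);
  fmap_id : forall x : A, fmap (cat_id x) = cat_id (fobj x);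
  fmap_comp : forall (x y z : A) (g : hom y z) (f : hom x y),
    fmap (cat_comp g f) = cat_comp (fmap g) (fmap f)
}.
Arguments fmap {A B} F {x y} f : rename.

Program Definition id_functor (A : category) : functor A A :=
  @Functor A A (fun x => x) (fun _ _ f => f) _ _.

Program Definition comp_functor (A B C : category)
    (G : functor B C) (F : functor A B) : functor A C :=
  @Functor A C (fun x => G (F x)) (fun _ _ f => fmap G (fmap F f)) _ _.
Next Obligation. by move=> A B C G F x /=; rewrite !fmap_id. Qed.
Next Obligation. by move=> A B C G F x y z g f /=; rewrite !fmap_comp. Qed.

Record nat_trans (A B : category) (F G : functor A B) := NatTrans {
  component :> forall x : A, hom (F x) (G x);
  naturality : forall (x y : A) (f : hom x y),
    cat_comp (component y) (fmap F f) = cat_comp (fmap G f) (component x)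
}.

Record adjunction (A B : category) (F : functor A B) (U : functor B A) :=
  Adjunction {
    adj_unit : nat_trans (id_functor A) (comp_functor U F);
    adj_counit : nat_trans (comp_functor F U) (id_functor B);
    adj_triangle_left : forall x : A,
      cat_comp (adj_counit (F x)) (fmap F (adj_unit x)) = cat_id (F x);
    adj_triangle_right : forall y : B,
      cat_comp (fmap U (adj_counit y)) (adj_unit (U y)) = cat_id (U y)
  }.

Program Definition adj_mult (A B : category) (F : functor A B)
    (U : functor B A) (adj : adjunction F U) :
    nat_trans (comp_functor (comp_functor U F) (comp_functor U F))
              (comp_functor U F) :=
  @NatTrans _ _ (comp_functor (comp_functor U F) (comp_functor U F))
    (comp_functor U F) (fun x => fmap U (adj_counit adj (F x))) _.
Next Obligation.
move=> A B F U adj x y f /=; rewrite -!fmap_comp.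
by congr (fmap U _); exact: (naturality (adj_counit adj)).
Qed.

Record is_monad (A : category) (T : functor A A)
    (eta : nat_trans (id_functor A) T) (mu : nat_trans (comp_functor T T) T) :
    Prop := IsMonad {
  monad_unit_left : forall x : A, cat_comp (mu x) (eta (T x)) = cat_id (T x);
  monad_unit_right : forall x : A,
    cat_comp (mu x) (fmap T (eta x)) = cat_id (T x);
  monad_assoc : forall x : A,
    cat_comp (mu x) (mu (T x)) = cat_comp (mu x) (fmap T (mu x))
}.

Program Definition prod_category (A B : category) : category :=
  @Category (A * B)%type
    (fun x y => (hom x.1 y.1 * hom x.2 y.2)%type)
    (fun x => (cat_id x.1, cat_id x.2))
    (fun _ _ _ g f => (cat_comp g.1 f.1, cat_comp g.2 f.2)) _ _ _.
Next Obligation. by move=> A B x y [f g] /=; rewrite !cat_idl. Qed.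
Next Obligation. by move=> A B x y [f g] /=; rewrite !cat_idr. Qed.
Next Obligation. by move=> A B w x y z h g f /=; rewrite !cat_assoc. Qed.

(** * Cubical sets *)

Inductive side := Src | Tgt.

Record cubical_set := CubicalSet {
  cell :> nat -> Type;
  face : side -> forall {n}, 'I_n.+1 -> cell n.+1 -> cell n;
  face_face : forall (r r' : side) n (i j : 'I_n.+2) (i' j' : 'I_n.+1)
      (x : cell n.+2),
    i < j -> i' = i :> nat -> j'.+1 = j ->
    face r i' (face r' j x) = face r' j' (face r i x)
}.
Arguments face {c} r {n} j x : rename.

Notation src := (face Src).
Notation tgt := (face Tgt).

Record cset_hom (C D : cubical_set) := CsetHom {
  cset_map :> forall n, C n -> D n;
  cset_map_face : forall r n (j : 'I_n.+1) (x : C n.+1),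
    cset_map (face r j x) = face r j (cset_map x)
}.

Lemma cset_hom_eq (C D : cubical_set) (f g : cset_hom C D) :
  (forall n x, f n x = g n x) -> f = g.
Proof.
case: f g => [f hf] [g hg] /= fg.
have {}fg : f = g by apply: functional_extensionality_dep => n; exact/funext.
by subst g; congr CsetHom; exact: Prop_irrelevance.
Qed.

Definition cset_id (C : cubical_set) : cset_hom C C :=
  @CsetHom C C (fun _ x => x) (fun _ _ _ _ => erefl).

Program Definition cset_comp (C D E : cubical_set)
    (g : cset_hom D E) (f : cset_hom C D) : cset_hom C E :=
  @CsetHom C E (fun n x => g n (f n x)) _.
Next Obligation. by move=> C D E g f r n j x /=; rewrite !cset_map_face. Qed.

Program Definition CSets : category :=
  @Category cubical_set cset_hom cset_id cset_comp _ _ _.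
Next Obligation. by move=> C D f; exact: cset_hom_eq. Qed.
Next Obligation. by move=> C D f; exact: cset_hom_eq. Qed.
Next Obligation. by move=> C D E G h g f; exact: cset_hom_eq. Qed.

(** * Reflexive cubical sets *)

Inductive sign := Minus | Plus.

Record reflexive_cubical_set := ReflexiveCubicalSet {
  reflexive_cset :> cubical_set;

  refl : forall {n}, 'I_n.+1 -> reflexive_cset n -> reflexive_cset n.+1;
  conn : sign -> forall {n},
    'I_n.+1 -> reflexive_cset n.+1 -> reflexive_cset n.+2;

  refl_refl : forall n (i j' : 'I_n.+2) (j i' : 'I_n.+1)
      (x : reflexive_cset n),
    i <= j -> j' = j.+1 :> nat -> i' = i :> nat ->
    refl i (refl j x) = refl j' (refl i' x);

  face_refl_lt : forall r n (i j : 'I_n.+2) (i' j' : 'I_n.+1)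
      (x : reflexive_cset n.+1),
    i < j -> i' = i :> nat -> j'.+1 = j ->
    face r i (refl j x) = refl j' (face r i' x);
  face_refl_gt : forall r n (i j : 'I_n.+2) (i' j' : 'I_n.+1)
      (x : reflexive_cset n.+1),
    j < i -> i'.+1 = i -> j' = j :> nat ->
    face r i (refl j x) = refl j' (face r i' x);
  face_refl_eq : forall r n (j : 'I_n.+1) (x : reflexive_cset n),
    face r j (refl j x) = x;

  conn_conn_lt : forall g n (i j' : 'I_n.+2) (j i' : 'I_n.+1)
      (x : reflexive_cset n.+1),
    i < j -> j' = j.+1 :> nat -> i' = i :> nat ->
    conn g i (conn g j x) = conn g j' (conn g i' x);
  conn_conn_eq : forall g n (i i' : 'I_n.+2) (j : 'I_n.+1)
      (x : reflexive_cset n.+1),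
    i = j :> nat -> i' = j.+1 :> nat ->
    conn g i (conn g j x) = conn g i' (conn g j x);

  conn_refl_lt : forall g n (i j : 'I_n.+2) (i' : 'I_n.+1) (j' : 'I_n.+3)
      (x : reflexive_cset n.+1),
    i < j -> j' = j.+1 :> nat -> i' = i :> nat ->
    conn g i (refl j x) = refl j' (conn g i' x);
  conn_refl_gt : forall g n (i j : 'I_n.+2) (i' : 'I_n.+1) (j' : 'I_n.+3)
      (x : reflexive_cset n.+1),
    j < i -> j' = j :> nat -> i'.+1 = i ->
    conn g i (refl j x) = refl j' (conn g i' x);
  conn_refl_eq : forall g n (j : 'I_n.+1) (j' : 'I_n.+2)
      (x : reflexive_cset n),
    j' = j :> nat ->
    conn g j (refl j x) = refl j' (refl j x);

  face_conn_lt : forall r g n (i : 'I_n.+3) (j i' : 'I_n.+2) (j' : 'I_n.+1)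
      (x : reflexive_cset n.+2),
    i < j -> i' = i :> nat -> j'.+1 = j ->
    face r i (conn g j x) = conn g j' (face r i' x);
  face_conn_gt : forall r g n (i : 'I_n.+3) (j i' : 'I_n.+2) (j' : 'I_n.+1)
      (x : reflexive_cset n.+2),
    j.+1 < i -> i'.+1 = i -> j' = j :> nat ->
    face r i (conn g j x) = conn g j' (face r i' x);

  src_conn_minus : forall n (i : 'I_n.+2) (j : 'I_n.+1)
      (x : reflexive_cset n.+1),
    i = j :> nat \/ i = j.+1 :> nat ->
    src i (conn Minus j x) = x;
  tgt_conn_plus : forall n (i : 'I_n.+2) (j : 'I_n.+1)
      (x : reflexive_cset n.+1),
    i = j :> nat \/ i = j.+1 :> nat ->
    tgt i (conn Plus j x) = x;
  src_conn_plus : forall n (i : 'I_n.+2) (j : 'I_n.+1)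
      (x : reflexive_cset n.+1),
    i = j :> nat \/ i = j.+1 :> nat ->
    src i (conn Plus j x) = refl j (src j x);
  tgt_conn_minus : forall n (i : 'I_n.+2) (j : 'I_n.+1)
      (x : reflexive_cset n.+1),
    i = j :> nat \/ i = j.+1 :> nat ->
    tgt i (conn Minus j x) = refl j (tgt j x)
}.
Arguments refl {r n} j x : rename.
Arguments conn {r} g {n} j x : rename.

(** * Cubical reflexive infinity-magmas *)

Definition composable (C : cubical_set) n (j : 'I_n.+1) (a b : C n.+1) : Prop :=
  tgt j a = src j b.

Unset Implicit Arguments.
Record magma := Magma {
  magma_rcset :> reflexive_cubical_set;

  comp : forall {n} (j : 'I_n.+1) (a b : magma_rcset n.+1),
    composable j a b -> magma_rcset n.+1;

  src_comp : forall n (j : 'I_n.+1) (a b : magma_rcset n.+1)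
      (h : composable j a b),
    src j (comp j a b h) = src j a;
  tgt_comp : forall n (j : 'I_n.+1) (a b : magma_rcset n.+1)
      (h : composable j a b),
    tgt j (comp j a b h) = tgt j b;
  face_comp_lt : forall r n (i j : 'I_n.+2) (j' : 'I_n.+1)
      (a b : magma_rcset n.+2) (h : composable j a b),
    i < j -> j'.+1 = j ->
    exists h', face r i (comp j a b h) = comp j' (face r i a) (face r i b) h';
  face_comp_gt : forall r n (i j : 'I_n.+2) (j' : 'I_n.+1)
      (a b : magma_rcset n.+2) (h : composable j a b),
    j < i -> j' = j :> nat ->
    exists h', face r i (comp j a b h) = comp j' (face r i a) (face r i b) h'
}.
Set Implicit Arguments.
Arguments comp {m n} j a b h : rename.

Record magma_hom (M N : magma) := MagmaHom {
  magma_cset_hom :> cset_hom M N;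
  magma_map_refl : forall n (j : 'I_n.+1) (x : M n),
    magma_cset_hom n.+1 (refl j x) = refl j (magma_cset_hom n x);
  magma_map_conn : forall g n (j : 'I_n.+1) (x : M n.+1),
    magma_cset_hom n.+2 (conn g j x) = conn g j (magma_cset_hom n.+1 x);
  magma_map_comp : forall n (j : 'I_n.+1) (a b : M n.+1)
      (h : composable j a b),
    exists h', magma_cset_hom n.+1 (comp j a b h)
      = comp j (magma_cset_hom n.+1 a) (magma_cset_hom n.+1 b) h'
}.

Lemma magma_hom_eq (M N : magma) (f g : magma_hom M N) :
  (forall n x, f n x = g n x) -> f = g.
Proof.
case: f g => [f f1 f2 f3] [g g1 g2 g3] /= /cset_hom_eq fg.
by subst g; congr MagmaHom; exact: Prop_irrelevance.
Qed.

Program Definition magma_id (M : magma) : magma_hom M M :=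
  @MagmaHom M M (cset_id M) _ _ _.
Next Obligation. by move=> M n j a b h /=; exists h. Qed.

Program Definition magma_comp (M N P : magma)
    (g : magma_hom N P) (f : magma_hom M N) : magma_hom M P :=
  @MagmaHom M P (cset_comp g f) _ _ _.
Next Obligation. by move=> M N P g f n j x /=; rewrite !magma_map_refl. Qed.
Next Obligation. by move=> M N P g f s n j x /=; rewrite !magma_map_conn. Qed.
Next Obligation.
move=> M N P g f n j a b h /=.
have [h1 ->] := magma_map_comp f h.
by have [h2 ->] := magma_map_comp g h1; exists h2.
Qed.

(** * Strict cubical infinity-categories *)

Record is_strict (C : magma) : Prop := IsStrict {
  comp_assoc : forall n (j : 'I_n.+1) (a b c : C n.+1)
      (hab : composable j a b) (habc : composable j (comp j a b hab) c),
    exists hbc habc',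
      comp j (comp j a b hab) c habc = comp j a (comp j b c hbc) habc';
  comp_unit_left : forall n (j : 'I_n.+1) (a : C n.+1),
    exists h, comp j (refl j (src j a)) a h = a;
  comp_unit_right : forall n (j : 'I_n.+1) (a : C n.+1),
    exists h, comp j a (refl j (tgt j a)) h = a;

  interchange : forall n (i j : 'I_n.+1) (a b c d : C n.+1)
      (hab : composable i a b) (hcd : composable i c d)
      (hac : composable j a c) (hbd : composable j b d)
      (hl : composable j (comp i a b hab) (comp i c d hcd))
      (hr : composable i (comp j a c hac) (comp j b d hbd)),
    i != j ->
    comp j (comp i a b hab) (comp i c d hcd) hl
      = comp i (comp j a c hac) (comp j b d hbd) hr;

  refl_comp_le : forall n (i j' : 'I_n.+2) (j : 'I_n.+1) (a b : C n.+1)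
      (h : composable j a b),
    i <= j -> j' = j.+1 :> nat ->
    exists h', refl i (comp j a b h) = comp j' (refl i a) (refl i b) h';
  refl_comp_gt : forall n (i j' : 'I_n.+2) (j : 'I_n.+1) (a b : C n.+1)
      (h : composable j a b),
    j < i -> j' = j :> nat ->
    exists h', refl i (comp j a b h) = comp j' (refl i a) (refl i b) h';

  conn_comp_lt : forall g n (i j : 'I_n.+1) (j' : 'I_n.+2) (a b : C n.+1)
      (h : composable j a b),
    i < j -> j' = j.+1 :> nat ->
    exists h', conn g i (comp j a b h) = comp j' (conn g i a) (conn g i b) h';
  conn_comp_gt : forall g n (i j : 'I_n.+1) (j' : 'I_n.+2) (a b : C n.+1)
      (h : composable j a b),
    j < i -> j' = j :> nat ->
    exists h', conn g i (comp j a b h) = comp j' (conn g i a) (conn g i b) h';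

  transport_plus : forall n (j : 'I_n.+1) (j0 j1 : 'I_n.+2) (a b : C n.+1)
      (h : composable j a b),
    j0 = j :> nat -> j1 = j.+1 :> nat ->
    exists h1 h2 h3,
      conn Plus j (comp j a b h)
        = comp j1 (comp j0 (conn Plus j a) (refl j0 a) h1)
                  (comp j0 (refl j1 a) (conn Plus j b) h2) h3;
  transport_minus : forall n (j : 'I_n.+1) (j0 j1 : 'I_n.+2) (a b : C n.+1)
      (h : composable j a b),
    j0 = j :> nat -> j1 = j.+1 :> nat ->
    exists h1 h2 h3,
      conn Minus j (comp j a b h)
        = comp j1 (comp j0 (conn Minus j a) (refl j1 b) h1)
                  (comp j0 (refl j0 b) (conn Minus j b) h2) h3;

  conn_plus_minus : forall n (i : 'I_n.+1) (i0 i1 : 'I_n.+2) (x : C n.+1),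
    i0 = i :> nat -> i1 = i.+1 :> nat ->
    exists h, comp i0 (conn Plus i x) (conn Minus i x) h = refl i1 x;
  conn_plus_minus' : forall n (i : 'I_n.+1) (i0 i1 : 'I_n.+2) (x : C n.+1),
    i0 = i :> nat -> i1 = i.+1 :> nat ->
    exists h, comp i1 (conn Plus i x) (conn Minus i x) h = refl i0 x
}.

Record strict_category := StrictCategory {
  strict_magma :> magma;
  strict_axioms : is_strict strict_magma
}.

Definition strict_functor (C D : strict_category) := magma_hom C D.

(** * Cubical categorical stretchings *)

Section BracketDomains.
Variables (M C : magma) (p : magma_hom M C).

(* In dimension 0 brackets are only defined on the diagonal. *)
Definition brk_dom n : M n -> M n -> Prop :=
  match n return M n -> M n -> Prop with
  | 0 => fun a b => a = b
  | m.+1 => fun a b => p m.+1 a = p m.+1 b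
  end.

Definition conn_side (g : sign) : side :=
  match g with Minus => Src | Plus => Tgt end.

Definition cbrk_dom (g : sign) n (j : 'I_n.+1) (a b : M n.+1) : Prop :=
  brk_dom a b /\ face (conn_side g) j a = face (conn_side g) j b.

End BracketDomains.

Unset Implicit Arguments.
(* In [brk_face_lt] and [brk_face_gt], and in [src_cbrk_plus] and
   [tgt_cbrk_minus], the definedness of the right-hand side is an actual
   condition when [n = 0]: if two 1-cells of the magma have the same image
   under the projection, then they have the same faces. *)
Record stretching := Stretching {
  str_magma : magma;
  str_cat : strict_category;
  str_proj : magma_hom str_magma str_cat;

  brk : forall {n} (j : 'I_n.+1) (a b : str_magma n),
    brk_dom str_proj a b -> str_magma n.+1;
  cbrk : forall g {n} (j : 'I_n.+1) (a b : str_magma n.+1),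
    cbrk_dom str_proj g j a b -> str_magma n.+2;

  brk_face_lt : forall r n (i j : 'I_n.+2) (i' j' : 'I_n.+1)
      (a b : str_magma n.+1) (h : brk_dom str_proj a b),
    i < j -> i' = i :> nat -> j'.+1 = j ->
    exists h', face r i (brk j a b h) = brk j' (face r i' a) (face r i' b) h';
  brk_face_gt : forall r n (i j : 'I_n.+2) (i' j' : 'I_n.+1)
      (a b : str_magma n.+1) (h : brk_dom str_proj a b),
    j < i -> i'.+1 = i -> j' = j :> nat ->
    exists h', face r i (brk j a b h) = brk j' (face r i' a) (face r i' b) h';
  src_brk : forall n (j : 'I_n.+1) (a b : str_magma n)
      (h : brk_dom str_proj a b),
    src j (brk j a b h) = a;
  tgt_brk : forall n (j : 'I_n.+1) (a b : str_magma n)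
      (h : brk_dom str_proj a b),
    tgt j (brk j a b h) = b;

  proj_brk : forall n (j : 'I_n.+1) (a b : str_magma n)
      (h : brk_dom str_proj a b),
    str_proj n.+1 (brk j a b h) = refl j (str_proj n a) /\
    str_proj n.+1 (brk j a b h) = refl j (str_proj n b);
  brk_diag : forall n (j : 'I_n.+1) (a : str_magma n),
    exists h, brk j a a h = refl j a;

  src_cbrk_minus : forall n (i : 'I_n.+2) (j : 'I_n.+1)
      (a b : str_magma n.+1) (h : cbrk_dom str_proj Minus j a b),
    (i = j :> nat -> src i (cbrk Minus j a b h) = a) /\
    (i = j.+1 :> nat -> src i (cbrk Minus j a b h) = b);
  tgt_cbrk_plus : forall n (i : 'I_n.+2) (j : 'I_n.+1)
      (a b : str_magma n.+1) (h : cbrk_dom str_proj Plus j a b),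
    (i = j :> nat -> tgt i (cbrk Plus j a b h) = a) /\
    (i = j.+1 :> nat -> tgt i (cbrk Plus j a b h) = b);
  src_cbrk_plus : forall n (i : 'I_n.+2) (j : 'I_n.+1)
      (a b : str_magma n.+1) (h : cbrk_dom str_proj Plus j a b),
    i = j :> nat \/ i = j.+1 :> nat ->
    exists h', src i (cbrk Plus j a b h) = brk j (src j a) (src j b) h';
  tgt_cbrk_minus : forall n (i : 'I_n.+2) (j : 'I_n.+1)
      (a b : str_magma n.+1) (h : cbrk_dom str_proj Minus j a b),
    i = j :> nat \/ i = j.+1 :> nat ->
    exists h', tgt i (cbrk Minus j a b h) = brk j (tgt j a) (tgt j b) h';

  cbrk_face_lt : forall r g n (i : 'I_n.+3) (j i' : 'I_n.+2) (j' : 'I_n.+1)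
      (a b : str_magma n.+2) (h : cbrk_dom str_proj g j a b),
    i < j -> i' = i :> nat -> j'.+1 = j ->
    exists h', face r i (cbrk g j a b h)
      = cbrk g j' (face r i' a) (face r i' b) h';
  cbrk_face_gt : forall r g n (i : 'I_n.+3) (j i' : 'I_n.+2) (j' : 'I_n.+1)
      (a b : str_magma n.+2) (h : cbrk_dom str_proj g j a b),
    j.+1 < i -> i'.+1 = i -> j' = j :> nat ->
    exists h', face r i (cbrk g j a b h)
      = cbrk g j' (face r i' a) (face r i' b) h';

  proj_cbrk : forall g n (j : 'I_n.+1) (a b : str_magma n.+1)
      (h : cbrk_dom str_proj g j a b),
    str_proj n.+2 (cbrk g j a b h) = conn g j (str_proj n.+1 a) /\
    str_proj n.+2 (cbrk g j a b h) = conn g j (str_proj n.+1 b);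
  cbrk_diag : forall g n (j : 'I_n.+1) (a : str_magma n.+1),
    exists h, cbrk g j a a h = conn g j a
}.
Set Implicit Arguments.
Arguments brk {s n} j a b h : rename.
Arguments cbrk {s} g {n} j a b h : rename.

Record stretching_hom (E E' : stretching) := StretchingHom {
  str_magma_hom : magma_hom (str_magma E) (str_magma E');
  str_cat_hom : strict_functor (str_cat E) (str_cat E');
  str_hom_proj : forall n (x : str_magma E n),
    str_proj E' n (str_magma_hom n x) = str_cat_hom n (str_proj E n x);
  str_hom_brk : forall n (j : 'I_n.+1) (a b : str_magma E n)
      (h : brk_dom (str_proj E) a b),
    exists h', str_magma_hom n.+1 (brk j a b h)
      = brk j (str_magma_hom n a) (str_magma_hom n b) h';
  str_hom_cbrk : forall g n (j : 'I_n.+1) (a b : str_magma E n.+1)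
      (h : cbrk_dom (str_proj E) g j a b),
    exists h', str_magma_hom n.+2 (cbrk g j a b h)
      = cbrk g j (str_magma_hom n.+1 a) (str_magma_hom n.+1 b) h'
}.

Lemma stretching_hom_eq (E E' : stretching) (f g : stretching_hom E E') :
  (forall n x, str_magma_hom f n x = str_magma_hom g n x) ->
  (forall n x, str_cat_hom f n x = str_cat_hom g n x) -> f = g.
Proof.
case: f g => [f f' f1 f2 f3] [g g' g1 g2 g3] /= /magma_hom_eq fg.
move=> /magma_hom_eq fg'.
by subst g g'; congr StretchingHom; exact: Prop_irrelevance.
Qed.

Program Definition stretching_id (E : stretching) : stretching_hom E E :=
  @StretchingHom E E (magma_id _) (magma_id _) _ _ _.
Next Obligation. by move=> E n j a b h /=; exists h. Qed.
Next Obligation. by move=> E g n j a b h /=; exists h. Qed.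

Program Definition stretching_comp (E E' E'' : stretching)
    (g : stretching_hom E' E'') (f : stretching_hom E E') :
    stretching_hom E E'' :=
  @StretchingHom E E'' (magma_comp (str_magma_hom g) (str_magma_hom f))
    (magma_comp (str_cat_hom g) (str_cat_hom f)) _ _ _.
Next Obligation. by move=> E E' E'' g f n x /=; rewrite !str_hom_proj. Qed.
Next Obligation.
move=> E E' E'' g f n j a b h /=.
have [h1 ->] := str_hom_brk f j h.
by have [h2 ->] := str_hom_brk g j h1; exists h2.
Qed.
Next Obligation.
move=> E E' E'' g f s n j a b h /=.
have [h1 ->] := str_hom_cbrk f h.
by have [h2 ->] := str_hom_cbrk g h1; exists h2.
Qed.

(** * Cubical (0, infinity)-categorical stretchings *)

Record zero_stretching := ZeroStretching {
  zs_dom : stretching;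
  zs_cod : stretching;
  zs_magma_map : cset_hom (str_magma zs_dom) (str_magma zs_cod);
  zs_cat_map : strict_functor (str_cat zs_dom) (str_cat zs_cod);
  zs_square : forall n (x : str_magma zs_dom n),
    str_proj zs_cod n (zs_magma_map n x) = zs_cat_map n (str_proj zs_dom n x)
}.

Record zero_stretching_hom (E E' : zero_stretching) := ZeroStretchingHom {
  zs_hom_dom : stretching_hom (zs_dom E) (zs_dom E');
  zs_hom_cod : stretching_hom (zs_cod E) (zs_cod E');
  zs_hom_magma_square : forall n (x : str_magma (zs_dom E) n),
    str_magma_hom zs_hom_cod n (zs_magma_map E n x)
      = zs_magma_map E' n (str_magma_hom zs_hom_dom n x);
  zs_hom_cat_square : forall n (x : str_cat (zs_dom E) n),
    str_cat_hom zs_hom_cod n (zs_cat_map E n x)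
      = zs_cat_map E' n (str_cat_hom zs_hom_dom n x)
}.

Lemma zero_stretching_hom_eq (E E' : zero_stretching)
    (f g : zero_stretching_hom E E') :
  zs_hom_dom f = zs_hom_dom g -> zs_hom_cod f = zs_hom_cod g -> f = g.
Proof.
case: f g => [f f' f1 f2] [g g' g1 g2] /= fg fg'.
by subst g g'; congr ZeroStretchingHom; exact: Prop_irrelevance.
Qed.

Definition zero_stretching_id (E : zero_stretching) : zero_stretching_hom E E :=
  @ZeroStretchingHom E E (stretching_id _) (stretching_id _)
    (fun _ _ => erefl) (fun _ _ => erefl).

Program Definition zero_stretching_comp (E E' E'' : zero_stretching)
    (g : zero_stretching_hom E' E'') (f : zero_stretching_hom E E') :
    zero_stretching_hom E E'' :=
  @ZeroStretchingHom E E''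
    (stretching_comp (zs_hom_dom g) (zs_hom_dom f))
    (stretching_comp (zs_hom_cod g) (zs_hom_cod f)) _ _.
Next Obligation.
by move=> E E' E'' g f n x /=; rewrite !zs_hom_magma_square.
Qed.
Next Obligation.
by move=> E E' E'' g f n x /=; rewrite !zs_hom_cat_square.
Qed.

Program Definition ZeroStretchings : category :=
  @Category zero_stretching zero_stretching_hom zero_stretching_id
    zero_stretching_comp _ _ _.
Next Obligation.
by move=> E E' f; apply: zero_stretching_hom_eq; exact: stretching_hom_eq.
Qed.
Next Obligation.
by move=> E E' f; apply: zero_stretching_hom_eq; exact: stretching_hom_eq.
Qed.
Next Obligation.
move=> E0 E1 E2 E3 h g f.
by apply: zero_stretching_hom_eq; exact: stretching_hom_eq.
Qed.

Program Definition forget :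
    functor ZeroStretchings (prod_category CSets CSets) :=
  @Functor ZeroStretchings (prod_category CSets CSets)
    (fun E => (str_magma (zs_dom E) : cubical_set,
               str_magma (zs_cod E) : cubical_set))
    (fun _ _ f => (str_magma_hom (zs_hom_dom f) : cset_hom _ _,
                   str_magma_hom (zs_hom_cod f) : cset_hom _ _)) _ _.

(* Main.v *)
From mathcomp Require Import all_boot.
From mathcomp Require Import boolp.
Require Import Defs.

Set Implicit Arguments.
Unset Strict Implicit.
Unset Printing Implicit Defensive.

#[local] Obligation Tactic := idtac.

(** The (0, infinity)-stretchings are the models of a partial equational theory:
    every operation is defined on the solutions of equations, and every axiom is
    a Horn clause.  Hence the product, over all pairs [(E, f)] of a stretching
    [E] and a map [f] from [X] to the cubical sets of [E], of the cells of [E]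
    satisfies all the axioms, and so does its smallest substructure that contains
    the image of [X].  This substructure is the free stretching on [X].  Its
    projection to the factor [(E, f)] is a morphism that extends [f], and it is
    the only one, because two morphisms that agree on [X] agree on everything
    that [X] generates ([free_cell_ind], [hom_free_eq]).

    The product is indexed by all stretchings, so its cells live in a universe
    above that of the cells of a stretching.  The substructure is nevertheless
    small.  Each of its cells is the value of a formal term ([eval]), and
    there are only as many terms as the universe of [X] allows; a cell
    is therefore encoded as the class of the terms that have a given value
    ([free_cell]), and [value] recovers the family of cells that it stands for.
    As [value] is injective ([value_inj]), each axiom of the free stretching
    reduces to the same axiom in every [E].  The lemmas [composableP],
    [brk_domP] and [cbrk_domP] say that a partial operation is defined in the
    free stretching exactly when it is defined in every [E].

    A universal arrow from each [X] amounts to a left adjoint, and every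
    adjunction induces a monad. *)

(** * Adjunctions from universal arrows *)

Section UniversalArrows.
Variables (A B : category) (U : functor B A) (free : A -> B).
Variables (eta : forall x, hom x (U (free x)))
          (ext : forall x y, hom x (U y) -> hom (free x) y).
Hypothesis ext_eta : forall x y (f : hom x (U y)),
  cat_comp (fmap U (ext f)) (eta x) = f.
Hypothesis hom_free_eq : forall x y (g h : hom (free x) y),
  cat_comp (fmap U g) (eta x) = cat_comp (fmap U h) (eta x) -> g = h.

Program Definition free_functor : functor A B :=
  @Functor A B free (fun x y f => ext (cat_comp (eta y) f)) _ _.
Next Obligation.
by move=> x; apply: hom_free_eq; rewrite ext_eta fmap_id cat_idr cat_idl.
Qed.
Next Obligation.
move=> x y z g f; apply: hom_free_eq.
by rewrite ext_eta fmap_comp -cat_assoc ext_eta !cat_assoc ext_eta.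
Qed.

Program Definition free_unit :
    nat_trans (id_functor A) (comp_functor U free_functor) :=
  @NatTrans _ _ (id_functor A) (comp_functor U free_functor) eta _.
Next Obligation. by move=> x y f /=; rewrite ext_eta. Qed.

Program Definition free_counit :
    nat_trans (comp_functor free_functor U) (id_functor B) :=
  @NatTrans _ _ (comp_functor free_functor U) (id_functor B)
    (fun y => ext (cat_id (U y))) _.
Next Obligation.
move=> x y f /=; apply: hom_free_eq.
by rewrite !fmap_comp -!cat_assoc !ext_eta cat_assoc ext_eta cat_idl cat_idr.
Qed.

Program Definition free_adjunction : adjunction free_functor U :=
  @Adjunction A B free_functor U free_unit free_counit _ _.
Next Obligation.
move=> x /=; apply: hom_free_eq.
by rewrite fmap_comp -cat_assoc ext_eta cat_assoc ext_eta fmap_id.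
Qed.
Next Obligation. by move=> y /=; rewrite ext_eta. Qed.

End UniversalArrows.

Lemma adjunction_monad (A B : category) (F : functor A B) (U : functor B A)
    (adj : adjunction F U) : is_monad (adj_unit adj) (adj_mult adj).
Proof.
split=> x /=.
- exact: adj_triangle_right.
- by rewrite -fmap_comp adj_triangle_left fmap_id.
- rewrite -!fmap_comp; congr (fmap U _).
  by rewrite -(naturality (adj_counit adj)).
Qed.

(** * Models and terms *)

(** A (0, infinity)-stretching has four families of cells, those of the magma
    ([Mg]) and of the strict category ([Ct]) of its domain ([false]) and of its
    codomain ([true]).  As all four are magmas, one family of magmas indexed by
    [bool * kind] lets the operations common to them be treated at once. *)
Inductive kind := Mg | Ct.

Definition str_at (E : zero_stretching) (i : bool) : stretching :=
  if i then zs_cod E else zs_dom E.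

Definition part (E : zero_stretching) (i : bool) (k : kind) : magma :=
  match k with
  | Mg => str_magma (str_at E i)
  | Ct => strict_magma (str_cat (str_at E i))
  end.

Definition part_map (E : zero_stretching) (k : kind) :
    cset_hom (part E false k) (part E true k) :=
  match k with
  | Mg => zs_magma_map E
  | Ct => magma_cset_hom (zs_cat_map E)
  end.

Section Free.
Variable X : prod_category CSets CSets.

Definition gen_cset (i : bool) : cubical_set := if i then X.2 else X.1.

Record model := Model {
  model_str :> zero_stretching;
  model_map : @hom (prod_category CSets CSets) X (forget model_str)
}.

Definition model_gen (e : model) (i : bool) :
    cset_hom (gen_cset i) (part e i Mg) :=
  match i return cset_hom (gen_cset i) (part e i Mg) with
  | true => (model_map e).2
  | false => (model_map e).1
  end.

(** The formal expressions built from the cells of [X] by the operations of a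
    (0, infinity)-stretching; [Proj] stands for both projections and [Map] for
    both horizontal maps.  Compositions and brackets are formed without any
    condition, so a term need not denote anything. *)
Inductive term : bool -> kind -> nat -> Type :=
| Gen i n (x : gen_cset i n) : term i Mg n
| Face i k (r : side) n (j : 'I_n.+1) (t : term i k n.+1) : term i k n
| Refl i k n (j : 'I_n.+1) (t : term i k n) : term i k n.+1
| Conn i k (g : sign) n (j : 'I_n.+1) (t : term i k n.+1) : term i k n.+2
| Comp i k n (j : 'I_n.+1) (t u : term i k n.+1) : term i k n.+1
| Brk i n (j : 'I_n.+1) (t u : term i Mg n) : term i Mg n.+1
| Cbrk i (g : sign) n (j : 'I_n.+1) (t u : term i Mg n.+1) : term i Mg n.+2
| Proj i n (t : term i Mg n) : term i Ct n
| Map k n (t : term false k n) : term true k n.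

(** These families form the product of all models, which lives in a larger
    universe than the cells of any of them. *)
Definition family i k n := forall e : model, part e i k n.

Definition family_face i k r n (j : 'I_n.+1) (x : family i k n.+1) :
    family i k n :=
  fun e => face r j (x e).
Definition family_refl i k n (j : 'I_n.+1) (x : family i k n) :
    family i k n.+1 :=
  fun e => refl j (x e).
Definition family_conn i k g n (j : 'I_n.+1) (x : family i k n.+1) :
    family i k n.+2 := fun e => conn g j (x e).
Definition family_proj i n (x : family i Mg n) : family i Ct n :=
  fun e => str_proj (str_at e i) n (x e).
Definition family_map k n (x : family false k n) : family true k n :=
  fun e => part_map e k n (x e).

Definition family_comp i k n (j : 'I_n.+1) (x y : family i k n.+1)
    (h : forall e, composable j (x e) (y e)) : family i k n.+1 :=
  fun e => comp j (x e) (y e) (h e).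
Definition family_brk i n (j : 'I_n.+1) (x y : family i Mg n)
    (h : forall e : model, brk_dom (str_proj (str_at e i)) (x e) (y e)) :
    family i Mg n.+1 :=
  fun e => brk j (x e : str_magma (str_at e i) n) (y e) (h e).
Definition family_cbrk i g n (j : 'I_n.+1) (x y : family i Mg n.+1)
    (h : forall e : model,
      cbrk_dom (str_proj (str_at e i)) g j (x e) (y e)) :
    family i Mg n.+2 :=
  fun e => cbrk g j (x e : str_magma (str_at e i) n.+1) (y e) (h e).

Definition partial_op (T T' : Type) (P : T -> T -> Prop)
    (op : forall x y, P x y -> T') (a b : option T) : option T' :=
  if a is Some x then if b is Some y then
    if pselect (P x y) is left h then Some (op x y h) else None
  else None else None.

(** A term has a value when it makes sense in all models simultaneously. *)
Fixpoint eval i k n (t : term i k n) : option (family i k n) :=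
  match t in term i k n return option (family i k n) with
  | Gen i n x => Some (fun e => model_gen e i n x)
  | Face i k r n j t => omap (@family_face i k r n j) (eval t)
  | Refl i k n j t => omap (@family_refl i k n j) (eval t)
  | Conn i k g n j t => omap (@family_conn i k g n j) (eval t)
  | Comp i k n j t u => partial_op (@family_comp i k n j) (eval t) (eval u)
  | Brk i n j t u => partial_op (@family_brk i n j) (eval t) (eval u)
  | Cbrk i g n j t u => partial_op (@family_cbrk i g n j) (eval t) (eval u)
  | Proj i n t => omap (@family_proj i n) (eval t)
  | Map k n t => omap (@family_map k n) (eval t)
  end.

(** * The cells of the free stretching *)

Definition definable i k n (x : family i k n) :=
  exists t : term i k n, eval t = Some x.

(** The definable families, brought down to the universe of the cells of [X]: a
    family is represented by the set of the terms of which it is the value. *)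
Definition free_cell i k n : Type :=
  {c : term i k n -> Prop |
    exists2 x, definable x & c = fun t => eval t = Some x}.

Definition cell_of i k n (x : family i k n) (dx : definable x) :
    free_cell i k n :=
  exist _ (fun t => eval t = Some x) (ex_intro2 _ _ x dx erefl).

Definition value i k n (c : free_cell i k n) : family i k n :=
  s2val (cid2 (svalP c)).

Lemma value_definable i k n (c : free_cell i k n) : definable (value c).
Proof. exact: s2valP. Qed.

Lemma value_inj i k n (c d : free_cell i k n) :
  (forall e, value c e = value d e) -> c = d.
Proof.
move=> cd; have {cd} : value c = value d.
  exact: functional_extensionality_dep.
rewrite /value; case: c d => [P hP] [Q hQ] /=.
case: cid2 => x _ /= cx; case: cid2 => y _ /= dy xy.
by apply: eq_exist; rewrite cx dy xy.
Qed.

Lemma value_cell_of i k n (x : family i k n) (dx : definable x) :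
  value (cell_of dx) = x.
Proof.
rewrite /value; case: cid2 => y [t ty] /= /(congr1 (fun P => P t)).
by rewrite ty => xy; have [] : Some y = Some x by rewrite xy.
Qed.

Lemma definable_face i k r n (j : 'I_n.+1) (c : free_cell i k n.+1) :
  definable (family_face r j (value c)).
Proof.
by have [t /= tc] := value_definable c; exists (Face r j t); rewrite /= tc.
Qed.

Lemma definable_refl i k n (j : 'I_n.+1) (c : free_cell i k n) :
  definable (family_refl j (value c)).
Proof.
by have [t /= tc] := value_definable c; exists (Refl j t); rewrite /= tc.
Qed.

Lemma definable_conn i k g n (j : 'I_n.+1) (c : free_cell i k n.+1) :
  definable (family_conn g j (value c)).
Proof.
by have [t /= tc] := value_definable c; exists (Conn g j t); rewrite /= tc.
Qed.

Lemma definable_proj i n (c : free_cell i Mg n) :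
  definable (family_proj (value c)).
Proof.
by have [t /= tc] := value_definable c; exists (Proj t); rewrite /= tc.
Qed.

Lemma definable_map k n (c : free_cell false k n) :
  definable (family_map (value c)).
Proof.
by have [t /= tc] := value_definable c; exists (Map t); rewrite /= tc.
Qed.

Lemma definable_gen i n (x : gen_cset i n) :
  definable (fun e => model_gen e i n x).
Proof. by exists (Gen x). Qed.

Lemma partial_opE (T T' : Type) (P : T -> T -> Prop)
    (op : forall x y, P x y -> T') x y (h : P x y) :
  partial_op op (Some x) (Some y) = Some (op x y h).
Proof.
rewrite /partial_op; case: pselect => // h'.
by rewrite (Prop_irrelevance h h').
Qed.

Lemma definable_comp i k n (j : 'I_n.+1) (a b : free_cell i k n.+1)
    (h : forall e, composable j (value a e) (value b e)) :
  definable (family_comp h).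
Proof.
have [t ta] := value_definable a; have [u ub] := value_definable b.
by exists (Comp j t u); rewrite /= ta ub (partial_opE _ h).
Qed.

Lemma definable_brk i n (j : 'I_n.+1) (a b : free_cell i Mg n)
    (h : forall e : model,
      brk_dom (str_proj (str_at e i)) (value a e) (value b e)) :
  definable (family_brk j h).
Proof.
have [t ta] := value_definable a; have [u ub] := value_definable b.
by exists (Brk j t u); rewrite /= ta ub (partial_opE _ h).
Qed.

Lemma definable_cbrk i g n (j : 'I_n.+1) (a b : free_cell i Mg n.+1)
    (h : forall e : model,
      cbrk_dom (str_proj (str_at e i)) g j (value a e) (value b e)) :
  definable (family_cbrk h).
Proof.
have [t ta] := value_definable a; have [u ub] := value_definable b.
by exists (Cbrk g j t u); rewrite /= ta ub (partial_opE _ h).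
Qed.

Definition free_face i k r n (j : 'I_n.+1) (c : free_cell i k n.+1) :=
  cell_of (definable_face r j c).
Definition free_refl i k n (j : 'I_n.+1) (c : free_cell i k n) :=
  cell_of (definable_refl j c).
Definition free_conn i k g n (j : 'I_n.+1) (c : free_cell i k n.+1) :=
  cell_of (definable_conn g j c).
Definition free_proj_cell i n (c : free_cell i Mg n) :=
  cell_of (definable_proj c).
Definition free_map_cell k n (c : free_cell false k n) :=
  cell_of (definable_map c).
Definition free_gen i n (x : gen_cset i n) := cell_of (definable_gen x).

Lemma value_face i k r n (j : 'I_n.+1) (c : free_cell i k n.+1) e :
  value (free_face r j c) e = face r j (value c e).
Proof. by rewrite value_cell_of. Qed.

Lemma value_refl i k n (j : 'I_n.+1) (c : free_cell i k n) e :
  value (free_refl j c) e = refl j (value c e).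
Proof. by rewrite value_cell_of. Qed.

Lemma value_conn i k g n (j : 'I_n.+1) (c : free_cell i k n.+1) e :
  value (free_conn g j c) e = conn g j (value c e).
Proof. by rewrite value_cell_of. Qed.

Lemma value_proj i n (c : free_cell i Mg n) e :
  value (free_proj_cell c) e = str_proj (str_at e i) n (value c e).
Proof. by rewrite value_cell_of. Qed.

Lemma value_map k n (c : free_cell false k n) e :
  value (free_map_cell c) e = part_map e k n (value c e).
Proof. by rewrite value_cell_of. Qed.

Lemma value_gen i n (x : gen_cset i n) e :
  value (free_gen x) e = model_gen e i n x.
Proof. by rewrite value_cell_of. Qed.

(** * The axioms of the free stretching *)

Program Definition free_cset i k : cubical_set :=
  @CubicalSet (free_cell i k) (free_face (k:=k)) _.
Next Obligation.
move=> i k r r' n p q p' q' x lt_pq Ep Eq; apply: value_inj => e.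
by rewrite !value_face; exact: face_face.
Qed.

Program Definition free_rcset i k : reflexive_cubical_set :=
  @ReflexiveCubicalSet (free_cset i k) (@free_refl i k) (@free_conn i k)
    _ _ _ _ _ _ _ _ _ _ _ _ _ _ _.
Ltac pointwise lem :=
  intros; apply: value_inj => e;
  rewrite ?(value_face, value_refl, value_conn); exact: lem.
Next Obligation. pointwise refl_refl. Qed.
Next Obligation. pointwise face_refl_lt. Qed.
Next Obligation. pointwise face_refl_gt. Qed.
Next Obligation. pointwise face_refl_eq. Qed.
Next Obligation. pointwise conn_conn_lt. Qed.
Next Obligation. pointwise conn_conn_eq. Qed.
Next Obligation. pointwise conn_refl_lt. Qed.
Next Obligation. pointwise conn_refl_gt. Qed.
Next Obligation. pointwise conn_refl_eq. Qed.
Next Obligation. pointwise face_conn_lt. Qed.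
Next Obligation. pointwise face_conn_gt. Qed.
Next Obligation. pointwise src_conn_minus. Qed.
Next Obligation. pointwise tgt_conn_plus. Qed.
Next Obligation. pointwise src_conn_plus. Qed.
Next Obligation. pointwise tgt_conn_minus. Qed.

Lemma composableP i k n (j : 'I_n.+1) (a b : free_cset i k n.+1) :
  composable j a b <-> forall e, composable j (value a e) (value b e).
Proof.
rewrite /composable; split=> [h e|h].
  by rewrite -!value_face; exact: (congr1 (fun c => value c e) h).
by apply: value_inj => e; rewrite !value_face.
Qed.

Definition free_comp i k n (j : 'I_n.+1) (a b : free_cset i k n.+1)
    (h : composable j a b) : free_cset i k n.+1 :=
  cell_of (definable_comp ((composableP j a b).1 h)).

(** The arguments [x] and [y] are separated from [value a e] and [value b e]
    because the values of nested composites cannot be rewritten under the proof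
    that the outer composite is defined. *)
Lemma value_comp_at i k n (j : 'I_n.+1) (a b : free_cset i k n.+1)
    (h : composable j a b) e x y (h' : composable j x y) :
  value a e = x -> value b e = y -> value (free_comp h) e = comp j x y h'.
Proof.
move=> ax bY; subst; rewrite value_cell_of /family_comp; congr comp.
exact: Prop_irrelevance.
Qed.

Lemma value_comp i k n (j : 'I_n.+1) (a b : free_cset i k n.+1)
    (h : composable j a b) e :
  exists h', value (free_comp h) e = comp j (value a e) (value b e) h'.
Proof.
by exists ((composableP j a b).1 h e); exact: value_comp_at.
Qed.

(** The definedness of a composite is part of the conclusion: the laws that
    equate a cell with a composite also assert that the composite exists, and
    both statements are inherited from the models. *)
Lemma free_comp_eq i k n (j : 'I_n.+1) (c a b : free_cset i k n.+1) :
  (forall e, exists h, value c e = comp j (value a e) (value b e) h) ->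
  exists h : composable j a b, c = free_comp h.
Proof.
move=> hc.
have h : composable j a b by apply/composableP => e; case: (hc e).
exists h; apply: value_inj => e; case: (hc e) => h' ->; symmetry.
exact: value_comp_at.
Qed.

(** The form taken by both transport laws. *)
Lemma free_comp_comp_eq i k n (j l : 'I_n.+1) (x a b c d : free_cset i k n.+1) :
  (forall e, exists h1 h2 h3,
    value x e = comp j (comp l (value a e) (value b e) h1)
                       (comp l (value c e) (value d e) h2) h3) ->
  exists (h1 : composable l a b) (h2 : composable l c d)
    (h3 : composable j (free_comp h1) (free_comp h2)), x = free_comp h3.
Proof.
move=> hx.
have h1 : composable l a b by apply/composableP => e; case: (hx e).
have h2 : composable l c d by apply/composableP => e; case: (hx e) => ? [].
exists h1, h2; apply: free_comp_eq => e; case: (hx e) => p [q [r ->]].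
rewrite (value_comp_at h1 p erefl erefl) (value_comp_at h2 q erefl erefl).
by exists r.
Qed.

Program Definition free_part i k : magma :=
  @Magma (free_rcset i k) (@free_comp i k) _ _ _ _.
Next Obligation.
move=> i k n j a b h; apply: value_inj => e; rewrite !value_face.
by have [h' ->] := value_comp h e; exact: src_comp.
Qed.
Next Obligation.
move=> i k n j a b h; apply: value_inj => e; rewrite !value_face.
by have [h' ->] := value_comp h e; exact: tgt_comp.
Qed.
Next Obligation.
move=> i k r n p j j' a b h lt_pj Ej; apply: free_comp_eq => e.
by rewrite !value_face; have [h' ->] := value_comp h e; exact: face_comp_lt.
Qed.
Next Obligation.
move=> i k r n p j j' a b h lt_jp Ej; apply: free_comp_eq => e.
by rewrite !value_face; have [h' ->] := value_comp h e; exact: face_comp_gt.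
Qed.

Lemma free_strict i : is_strict (free_part i Ct).
Proof.
have st (e : model) : is_strict (part e i Ct) by exact: strict_axioms.
split.
- move=> n j a b c hab habc.
  have assoc e := comp_assoc (st e).
  have hbc : composable j b c.
    apply/composableP => e; have [h h'] := value_comp hab e.
    have := (composableP _ _ _).1 habc e; rewrite /= h' => hc.
    by have [] := assoc e _ _ _ _ _ h hc.
  exists hbc; apply: free_comp_eq => e; rewrite /=.
  have [h hE] := value_comp hab e.
  have := (composableP _ _ _).1 habc e; rewrite /= hE => hc.
  rewrite (value_comp_at habc hc hE erefl).
  have [h1 [h2 ->]] := assoc e _ _ _ _ _ h hc.
  by rewrite (value_comp_at hbc h1 erefl erefl); exists h2.
- move=> n j a; suff [h ha] : exists h, a = comp j (refl j (src j a)) a h.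
    by exists h.
  apply: free_comp_eq => e; rewrite value_refl value_face.
  by have [h ha] := comp_unit_left (st e) j (value a e); exists h; rewrite ha.
- move=> n j a; suff [h ha] : exists h, a = comp j a (refl j (tgt j a)) h.
    by exists h.
  apply: free_comp_eq => e; rewrite value_refl value_face.
  by have [h ha] := comp_unit_right (st e) j (value a e); exists h; rewrite ha.
- move=> n l j a b c d hab hcd hac hbd hl hr neq_lj; apply: value_inj => e.
  have [h1 E1] := value_comp hab e; have [h2 E2] := value_comp hcd e.
  have [h3 E3] := value_comp hac e; have [h4 E4] := value_comp hbd e.
  have := (composableP _ _ _).1 hl e; rewrite /= E1 E2 => h5.
  have := (composableP _ _ _).1 hr e; rewrite /= E3 E4 => h6.
  rewrite (value_comp_at hl h5 E1 E2) (value_comp_at hr h6 E3 E4).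
  exact: (interchange (st e)).
- move=> n l j' j a b h le_lj Ej; apply: free_comp_eq => e; rewrite !value_refl.
  by have [h' ->] := value_comp h e; exact: (refl_comp_le (st e)).
- move=> n l j' j a b h lt_jl Ej; apply: free_comp_eq => e; rewrite !value_refl.
  by have [h' ->] := value_comp h e; exact: (refl_comp_gt (st e)).
- move=> g n l j j' a b h lt_lj Ej; apply: free_comp_eq => e.
  rewrite !value_conn.
  by have [h' ->] := value_comp h e; exact: (conn_comp_lt (st e)).
- move=> g n l j j' a b h lt_jl Ej; apply: free_comp_eq => e.
  rewrite !value_conn.
  by have [h' ->] := value_comp h e; exact: (conn_comp_gt (st e)).
- move=> n j j0 j1 a b h E0 E1; apply: free_comp_comp_eq => e.
  rewrite !value_refl !value_conn.
  by have [h' ->] := value_comp h e; exact: (transport_plus (st e)).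
- move=> n j j0 j1 a b h E0 E1; apply: free_comp_comp_eq => e.
  rewrite !value_refl !value_conn.
  by have [h' ->] := value_comp h e; exact: (transport_minus (st e)).
- move=> n l l0 l1 x E0 E1.
  suff [h hx] :
      exists h, refl l1 x = comp l0 (conn Plus l x) (conn Minus l x) h.
    by exists h.
  apply: free_comp_eq => e; rewrite !value_conn value_refl.
  by have [h <-] := conn_plus_minus (st e) (value x e) E0 E1; exists h.
- move=> n l l0 l1 x E0 E1.
  suff [h hx] :
      exists h, refl l0 x = comp l1 (conn Plus l x) (conn Minus l x) h.
    by exists h.
  apply: free_comp_eq => e; rewrite !value_conn value_refl.
  by have [h <-] := conn_plus_minus' (st e) (value x e) E0 E1; exists h.
Qed.

Definition free_cat i : strict_category := StrictCategory (free_strict i).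

Program Definition free_proj_cset i :
    cset_hom (free_part i Mg) (free_part i Ct) :=
  @CsetHom (free_part i Mg) (free_part i Ct) (@free_proj_cell i) _.
Next Obligation.
move=> i r n j x; apply: value_inj => e.
by rewrite value_proj !value_face value_proj; exact: cset_map_face.
Qed.

Program Definition free_proj i : magma_hom (free_part i Mg) (free_cat i) :=
  @MagmaHom (free_part i Mg) (free_cat i) (free_proj_cset i) _ _ _.
Next Obligation.
move=> i n j x; apply: value_inj => e.
by rewrite value_proj !value_refl value_proj; exact: magma_map_refl.
Qed.
Next Obligation.
move=> i g n j x; apply: value_inj => e.
by rewrite value_proj !value_conn value_proj; exact: magma_map_conn.
Qed.
Next Obligation.
move=> i n j a b h; apply: free_comp_eq => e; rewrite !value_proj.
by have [h' ->] := value_comp h e; exact: magma_map_comp.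
Qed.

Program Definition free_map_cset k :
    cset_hom (free_part false k) (free_part true k) :=
  @CsetHom (free_part false k) (free_part true k) (@free_map_cell k) _.
Next Obligation.
move=> k r n j x; apply: value_inj => e.
by rewrite value_map !value_face value_map; exact: cset_map_face.
Qed.

Program Definition free_cat_map :
    strict_functor (free_cat false) (free_cat true) :=
  @MagmaHom (free_cat false) (free_cat true) (free_map_cset Ct) _ _ _.
Next Obligation.
move=> n j x; apply: value_inj => e.
by rewrite value_map !value_refl value_map; exact: magma_map_refl.
Qed.
Next Obligation.
move=> g n j x; apply: value_inj => e.
by rewrite value_map !value_conn value_map; exact: magma_map_conn.
Qed.
Next Obligation.
move=> n j a b h; apply: free_comp_eq => e; rewrite !value_map.
by have [h' ->] := value_comp h e; exact: magma_map_comp.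
Qed.

(** In dimension 0 this is the injectivity of [value]; in the other dimensions,
    that of [value] on the cells of the category. *)
Lemma brk_domP i n (a b : free_part i Mg n) :
  brk_dom (free_proj i) a b <->
  forall e : model, brk_dom (str_proj (str_at e i)) (value a e) (value b e).
Proof.
case: n a b => [|n] a b /=; split.
- by move=> -> e.
- by move=> h; apply: (@value_inj i Mg 0) => e; exact: h.
- by move=> h e; rewrite -!value_proj; exact: (congr1 (fun c => value c e) h).
- by move=> h; apply: value_inj => e; rewrite !value_proj; exact: h.
Qed.

Lemma cbrk_domP i g n (j : 'I_n.+1) (a b : free_part i Mg n.+1) :
  cbrk_dom (free_proj i) g j a b <->
  forall e : model,
    cbrk_dom (str_proj (str_at e i)) g j (value a e) (value b e).
Proof.
split=> [[h1 h2] e|h]; split.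
- exact: (brk_domP a b).1.
- by have := congr1 (fun c => value c e) h2; rewrite !value_face.
- by apply/(brk_domP a b) => e; case: (h e).
- by apply: value_inj => e; rewrite !value_face; case: (h e).
Qed.

Definition free_brk i n (j : 'I_n.+1) (a b : free_part i Mg n)
    (h : brk_dom (free_proj i) a b) : free_part i Mg n.+1 :=
  cell_of (definable_brk j ((brk_domP a b).1 h)).

Definition free_cbrk i g n (j : 'I_n.+1) (a b : free_part i Mg n.+1)
    (h : cbrk_dom (free_proj i) g j a b) : free_part i Mg n.+2 :=
  cell_of (definable_cbrk ((cbrk_domP g j a b).1 h)).

Lemma value_brk i n (j : 'I_n.+1) (a b : free_part i Mg n)
    (h : brk_dom (free_proj i) a b) (e : model) :
  exists h' : brk_dom (str_proj (str_at e i)) (value a e) (value b e),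
    value (free_brk j h) e
      = brk j (value a e : str_magma (str_at e i) n) (value b e) h'.
Proof. by rewrite value_cell_of /family_brk; eexists. Qed.

Lemma value_cbrk i g n (j : 'I_n.+1) (a b : free_part i Mg n.+1)
    (h : cbrk_dom (free_proj i) g j a b) (e : model) :
  exists h' : cbrk_dom (str_proj (str_at e i)) g j (value a e) (value b e),
    value (free_cbrk h) e
      = cbrk g j (value a e : str_magma (str_at e i) n.+1) (value b e) h'.
Proof. by rewrite value_cell_of /family_cbrk; eexists. Qed.

Lemma free_brk_eq i n (j : 'I_n.+1) (c : free_part i Mg n.+1)
    (a b : free_part i Mg n) :
  (forall e : model,
    exists h : brk_dom (str_proj (str_at e i)) (value a e) (value b e),
    value c e = brk j (value a e : str_magma (str_at e i) n) (value b e) h) ->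
  exists h : brk_dom (free_proj i) a b, c = free_brk j h.
Proof.
move=> hc.
have h : brk_dom (free_proj i) a b by apply/brk_domP => e; case: (hc e).
exists h; apply: value_inj => e; case: (hc e) => h1 ->.
by have [h2 ->] := value_brk j h e; rewrite (Prop_irrelevance h1 h2).
Qed.

Lemma free_cbrk_eq i g n (j : 'I_n.+1) (c : free_part i Mg n.+2)
    (a b : free_part i Mg n.+1) :
  (forall e : model,
    exists h : cbrk_dom (str_proj (str_at e i)) g j (value a e) (value b e),
    value c e
      = cbrk g j (value a e : str_magma (str_at e i) n.+1) (value b e) h) ->
  exists h : cbrk_dom (free_proj i) g j a b, c = free_cbrk h.
Proof.
move=> hc.
have h : cbrk_dom (free_proj i) g j a b by apply/cbrk_domP => e; case: (hc e).
exists h; apply: value_inj => e; case: (hc e) => h1 ->.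
by have [h2 ->] := value_cbrk h e; rewrite (Prop_irrelevance h1 h2).
Qed.

Program Definition free_stretching i : stretching :=
  @Stretching (free_part i Mg) (free_cat i) (free_proj i)
    (@free_brk i) (@free_cbrk i) _ _ _ _ _ _ _ _ _ _ _ _ _ _.
Next Obligation.
move=> i r n p j p' j' a b h lt_pj Ep Ej; apply: free_brk_eq => e.
rewrite !value_face; have [h' ->] := value_brk j h e.
exact: brk_face_lt.
Qed.
Next Obligation.
move=> i r n p j p' j' a b h lt_pj Ep Ej; apply: free_brk_eq => e.
rewrite !value_face; have [h' ->] := value_brk j h e.
exact: brk_face_gt.
Qed.
Next Obligation.
move=> i n j a b h; apply: value_inj => e; rewrite !value_face.
by have [h' ->] := value_brk j h e; exact: src_brk.
Qed.
Next Obligation.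
move=> i n j a b h; apply: value_inj => e; rewrite !value_face.
by have [h' ->] := value_brk j h e; exact: tgt_brk.
Qed.
Next Obligation.
move=> i n j a b h; split; apply: value_inj => e;
  rewrite value_proj value_refl value_proj; have [h' ->] := value_brk j h e.
- exact: (proj_brk _ _ _ _ _ _).1.
- exact: (proj_brk _ _ _ _ _ _).2.
Qed.
Next Obligation.
move=> i n j a; suff [h ha] : exists h, refl j a = free_brk (a:=a) (b:=a) j h.
  by exists h.
apply: free_brk_eq => e; rewrite value_refl.
by have [h <-] := brk_diag (str_at e i) n j (value a e); exists h.
Qed.
Next Obligation.
move=> i n p j a b h; split=> Ep; apply: value_inj => e; rewrite value_face;
  have [h' ->] := value_cbrk h e.
- exact: (src_cbrk_minus _ _ _ _ _ _ _).1.
- exact: (src_cbrk_minus _ _ _ _ _ _ _).2.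
Qed.
Next Obligation.
move=> i n p j a b h; split=> Ep; apply: value_inj => e; rewrite value_face;
  have [h' ->] := value_cbrk h e.
- exact: (tgt_cbrk_plus _ _ _ _ _ _ _).1.
- exact: (tgt_cbrk_plus _ _ _ _ _ _ _).2.
Qed.
Next Obligation.
move=> i n p j a b h Ep; apply: free_brk_eq => e; rewrite !value_face.
by have [h' ->] := value_cbrk h e; exact: src_cbrk_plus.
Qed.
Next Obligation.
move=> i n p j a b h Ep; apply: free_brk_eq => e; rewrite !value_face.
by have [h' ->] := value_cbrk h e; exact: tgt_cbrk_minus.
Qed.
Next Obligation.
move=> i r g n p j p' j' a b h lt_pj Ep Ej; apply: free_cbrk_eq => e.
rewrite !value_face; have [h' ->] := value_cbrk h e.
exact: cbrk_face_lt.
Qed.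
Next Obligation.
move=> i r g n p j p' j' a b h lt_pj Ep Ej; apply: free_cbrk_eq => e.
rewrite !value_face; have [h' ->] := value_cbrk h e.
exact: cbrk_face_gt.
Qed.
Next Obligation.
move=> i g n j a b h; split; apply: value_inj => e;
  rewrite value_proj value_conn value_proj; have [h' ->] := value_cbrk h e.
- exact: (proj_cbrk _ _ _ _ _ _ _).1.
- exact: (proj_cbrk _ _ _ _ _ _ _).2.
Qed.
Next Obligation.
move=> i g n j a.
suff [h ha] : exists h, conn g j a = free_cbrk (g:=g) (j:=j) (a:=a) (b:=a) h.
  by exists h.
apply: free_cbrk_eq => e; rewrite value_conn.
by have [h <-] := cbrk_diag (str_at e i) g n j (value a e); exists h.
Qed.

Program Definition free_zero_stretching : zero_stretching :=
  @ZeroStretching (free_stretching false) (free_stretching true)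
    (free_map_cset Mg) free_cat_map _.
Next Obligation.
move=> n x; apply: value_inj => e; rewrite value_proj !value_map value_proj.
exact: zs_square.
Qed.

(** * Universal property *)

Program Definition free_gen_map i : cset_hom (gen_cset i) (free_part i Mg) :=
  @CsetHom (gen_cset i) (free_part i Mg) (@free_gen i) _.
Next Obligation.
move=> i r n j x; apply: value_inj => e.
by rewrite value_face !value_gen; exact: cset_map_face.
Qed.

Definition free_eta :
    @hom (prod_category CSets CSets) X (forget free_zero_stretching) :=
  (free_gen_map false, free_gen_map true).

Section Evaluation.
Variable e : model.

Program Definition ev_cset i k : cset_hom (free_part i k) (part e i k) :=
  @CsetHom (free_part i k) (part e i k) (fun n c => value c e) _.
Next Obligation. by move=> i k r n j x; exact: value_face. Qed.

Program Definition ev_part i k : magma_hom (free_part i k) (part e i k) :=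
  @MagmaHom (free_part i k) (part e i k) (ev_cset i k) _ _ _.
Next Obligation. by move=> i k n j x; exact: value_refl. Qed.
Next Obligation. by move=> i k g n j x; exact: value_conn. Qed.
Next Obligation. by move=> i k n j a b h; exact: value_comp. Qed.

Program Definition ev_stretching i :
    stretching_hom (free_stretching i) (str_at e i) :=
  @StretchingHom (free_stretching i) (str_at e i) (ev_part i Mg) (ev_part i Ct)
    _ _ _.
Next Obligation. by move=> i n x; rewrite [RHS]value_proj. Qed.
Next Obligation. by move=> i n j a b h; exact: value_brk. Qed.
Next Obligation. by move=> i g n j a b h; exact: value_cbrk. Qed.

(** The projection of the product of all models to its factor [e]. *)
Program Definition ev : zero_stretching_hom free_zero_stretching e :=
  @ZeroStretchingHom free_zero_stretching e
    (ev_stretching false) (ev_stretching true) _ _.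
Next Obligation. by move=> n x; exact: (@value_map Mg). Qed.
Next Obligation. by move=> n x; exact: (@value_map Ct). Qed.

Lemma ev_eta : cat_comp (fmap forget (ev : @hom ZeroStretchings _ _)) free_eta
  = model_map e.
Proof.
rewrite [RHS]surjective_pairing; congr pair; apply: cset_hom_eq => n x.
- exact: (@value_gen false).
- exact: (@value_gen true).
Qed.

End Evaluation.

Lemma eval_value i k n (t : term i k n) x :
  eval t = Some x -> exists2 c, eval t = Some (value c) & value c = x.
Proof.
move=> tx; have dx : definable x by exists t.
by exists (cell_of dx); rewrite value_cell_of.
Qed.

Lemma omap_eval T i k n (t : term i k n) (f : family i k n -> T) y :
  omap f (eval t) = Some y ->
  exists2 c, eval t = Some (value c) & y = f (value c).
Proof.
case Et: (eval t) => [x|//] [<-].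
by have [c tc cx] := eval_value Et; exists c; rewrite -?cx -?tc.
Qed.

Lemma partial_op_eval T i k n (t u : term i k n)
    (P : family i k n -> family i k n -> Prop) (op : forall x y, P x y -> T) z :
  partial_op op (eval t) (eval u) = Some z ->
  exists a b, [/\ eval t = Some (value a), eval u = Some (value b) &
    exists h, z = op (value a) (value b) h].
Proof.
rewrite /partial_op.
case Et: (eval t) => [x|//]; case Eu: (eval u) => [y|//].
case: pselect => // h [<-].
have [a _ ax] := eval_value Et; have [b _ bY] := eval_value Eu; subst x y.
by exists a, b; split => //; exists h.
Qed.

(** The free stretching is generated by [X].  The operations that build a cell
    are read off a term that denotes it. *)
Lemma free_cell_ind (Q : forall i k n, free_cell i k n -> Prop) :
  (forall i n (x : gen_cset i n), Q i Mg n (free_gen x)) ->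
  (forall i k r n (j : 'I_n.+1) c, Q i k n.+1 c -> Q i k n (free_face r j c)) ->
  (forall i k n (j : 'I_n.+1) c, Q i k n c -> Q i k n.+1 (free_refl j c)) ->
  (forall i k g n (j : 'I_n.+1) c, Q i k n.+1 c ->
    Q i k n.+2 (free_conn g j c)) ->
  (forall i k n (j : 'I_n.+1) (a b : free_part i k n.+1) (h : composable j a b),
    Q i k n.+1 a -> Q i k n.+1 b -> Q i k n.+1 (free_comp h)) ->
  (forall i n (j : 'I_n.+1) (a b : free_part i Mg n)
      (h : brk_dom (free_proj i) a b),
    Q i Mg n a -> Q i Mg n b -> Q i Mg n.+1 (free_brk j h)) ->
  (forall i g n (j : 'I_n.+1) (a b : free_part i Mg n.+1)
      (h : cbrk_dom (free_proj i) g j a b),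
    Q i Mg n.+1 a -> Q i Mg n.+1 b -> Q i Mg n.+2 (free_cbrk h)) ->
  (forall i n c, Q i Mg n c -> Q i Ct n (free_proj_cell c)) ->
  (forall k n c, Q false k n c -> Q true k n (free_map_cell c)) ->
  forall i k n c, Q i k n c.
Proof.
move=> Qgen Qface Qrefl Qconn Qcomp Qbrk Qcbrk Qproj Qmap i k n c.
have [t] := value_definable c; elim: t c => {i k n}.
- move=> i n x c [cx]; suff -> : c = free_gen x by exact: Qgen.
  by apply: value_inj => e; rewrite value_gen -cx.
- move=> i k r n j t IH c /= tc; have [d td cd] := omap_eval tc.
  suff -> : c = free_face r j d by apply: Qface; exact: IH.
  by apply: value_inj => e; rewrite value_face cd.
- move=> i k n j t IH c /= tc; have [d td cd] := omap_eval tc.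
  suff -> : c = free_refl j d by apply: Qrefl; exact: IH.
  by apply: value_inj => e; rewrite value_refl cd.
- move=> i k g n j t IH c /= tc; have [d td cd] := omap_eval tc.
  suff -> : c = free_conn g j d by apply: Qconn; exact: IH.
  by apply: value_inj => e; rewrite value_conn cd.
- move=> i k n j t IHt u IHu c /= tc.
  have [a [b [ta ub [h ch]]]] := partial_op_eval tc.
  have [|h' ->] := @free_comp_eq i k n j c a b; last by apply: Qcomp; auto.
  by move=> e; exists (h e); rewrite ch.
- move=> i n j t IHt u IHu c /= tc.
  have [a [b [ta ub [h ch]]]] := partial_op_eval tc.
  have [|h' ->] := @free_brk_eq i n j c a b; last by apply: Qbrk; auto.
  by move=> e; exists (h e); rewrite ch.
- move=> i g n j t IHt u IHu c /= tc.
  have [a [b [ta ub [h ch]]]] := partial_op_eval tc.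
  have [|h' ->] := @free_cbrk_eq i g n j c a b; last by apply: Qcbrk; auto.
  by move=> e; exists (h e); rewrite ch.
- move=> i n t IH c /= tc; have [d td cd] := omap_eval tc.
  suff -> : c = free_proj_cell d by apply: Qproj; exact: IH.
  by apply: value_inj => e; rewrite value_proj cd.
- move=> k n t IH c /= tc; have [d td cd] := omap_eval tc.
  suff -> : c = free_map_cell d by apply: Qmap; exact: IH.
  by apply: value_inj => e; rewrite value_map cd.
Qed.

Section Uniqueness.
Variable E : zero_stretching.

Definition hom_at (g : zero_stretching_hom free_zero_stretching E) i :
    stretching_hom (free_stretching i) (str_at E i) :=
  match i with true => zs_hom_cod g | false => zs_hom_dom g end.

Definition hom_part (g : zero_stretching_hom free_zero_stretching E) i k :
    magma_hom (free_part i k) (part E i k) :=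
  match k with
  | Mg => str_magma_hom (hom_at g i)
  | Ct => str_cat_hom (hom_at g i)
  end.

Lemma hom_part_map g k n (c : free_cell false k n) :
  hom_part g true k n (free_map_cell c)
  = part_map E k n (hom_part g false k n c).
Proof.
case: k c => c.
- exact: (zs_hom_magma_square g).
- exact: (zs_hom_cat_square g).
Qed.

Lemma hom_free_eq (g h : @hom ZeroStretchings free_zero_stretching E) :
  cat_comp (fmap forget g) free_eta = cat_comp (fmap forget h) free_eta ->
  g = h.
Proof.
move=> gh_eta; suff gh i k n c : hom_part g i k n c = hom_part h i k n c.
  apply: zero_stretching_hom_eq; apply: stretching_hom_eq => n c.
  - exact: (gh false Mg).
  - exact: (gh false Ct).
  - exact: (gh true Mg).
  - exact: (gh true Ct).
move: i k n c; apply: free_cell_ind.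
- case=> n x.
  + exact: (congr1 (fun f : hom X (forget E) => f.2 n x) gh_eta).
  + exact: (congr1 (fun f : hom X (forget E) => f.1 n x) gh_eta).
- move=> i k r n j c IH.
  rewrite (cset_map_face (hom_part g i k)) (cset_map_face (hom_part h i k)).
  by rewrite IH.
- move=> i k n j c IH.
  rewrite (magma_map_refl (hom_part g i k)) (magma_map_refl (hom_part h i k)).
  by rewrite IH.
- move=> i k s n j c IH.
  rewrite (magma_map_conn (hom_part g i k)) (magma_map_conn (hom_part h i k)).
  by rewrite IH.
- move=> i k n j a b hab IHa IHb.
  have [] := magma_map_comp (hom_part g i k) hab.
  have [] := magma_map_comp (hom_part h i k) hab.
  rewrite IHa IHb => h1 -> h2 ->; congr comp; exact: Prop_irrelevance.
- move=> i n j a b hab IHa IHb.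
  have [] := str_hom_brk (hom_at g i) j hab.
  have [] := str_hom_brk (hom_at h i) j hab.
  rewrite IHa IHb => h1 -> h2 ->; congr brk; exact: Prop_irrelevance.
- move=> i s n j a b hab IHa IHb.
  have [] := str_hom_cbrk (hom_at g i) hab.
  have [] := str_hom_cbrk (hom_at h i) hab.
  rewrite IHa IHb => h1 -> h2 ->; congr cbrk; exact: Prop_irrelevance.
- move=> i n c IH /=.
  rewrite -(str_hom_proj (hom_at g i)) -(str_hom_proj (hom_at h i)).
  by congr (str_proj _ n _).
- by move=> k n c IH; rewrite !hom_part_map IH.
Qed.

End Uniqueness.

End Free.

Definition free_ext (X : prod_category CSets CSets) (E : ZeroStretchings)
    (f : hom X (forget E)) :
    @hom ZeroStretchings (free_zero_stretching X) E := ev (Model f).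

Lemma free_ext_eta X E (f : hom X (forget E)) :
  cat_comp (fmap forget (free_ext f)) (free_eta X) = f.
Proof. exact: (ev_eta (Model f)). Qed.

Theorem mainTheorem5 :
  exists (F : functor (prod_category CSets CSets) ZeroStretchings)
         (adj : adjunction F forget),
    is_monad (adj_unit adj) (adj_mult adj).
Proof.
exists (free_functor free_ext_eta (@hom_free_eq)).
exists (free_adjunction free_ext_eta (@hom_free_eq)).
exact: adjunction_monad.
Qed.
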